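(* Let $U$ and $\mathscr A$ be Hilbert spaces with $\tilde U\subset U$ and $\breve\alpha\in\tilde{\mathscr A}\subset\mathscr A$. Let $f:U\times\mathscr A\to\mathbb R$ and $g:U\times\mathscr A\to\mathbb R\cup\{\infty\}$ be convex, proper, and lower semicontinuous in their first argument. Suppose that $f$ is differentiable (in its first argument), $\nabla_u f$ is $L$-Lipschitz continuous, and $g$ is $\gamma$-strongly convex in $\tilde U$ for some $\gamma>0$. Moreover, assume that the solution map $S_u$ satisfying $0\in\nabla_uf(S_u(\alpha);\alpha)+\partial_ug(S_u(\alpha);\alpha)$ is single-valued and $L_{S_u}$-Lipschitz in $\tilde{\mathscr A}$. If the step length parameter $\tau>0$ satisfies $\tau L\le2$, then $$u^{k+1}=\operatorname{prox}_{\tau g(\cdot;\alpha)}\bigl(u^k-\tau\nabla_uf(u^k;\alpha)\bigr),$$ generated by the forward-backward algorithm for given $u^k\in\tilde U$ and $\alpha\in\tilde{\mathscr A}$, satisfies the inner tracking property: with $Q=\tau^{-1}\mathrm{Id}$ there are constants $\kappa_u>1$ and $\pi_u>0$, independent of $u^k,\alpha,\breve\alpha$, such that $$\kappa_u\|u^{k+1}-S_u(\alpha)\|_Q\le\|u^k-S_u(\breve\alpha)\|_Q+\pi_u\|\alpha-\breve\alpha\|.$$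
   Context: $\operatorname{prox}_h(x):=\arg\min_z\frac12\|z-x\|^2+h(z)$. $\mathrm{Id}$ is the identity operator. For self-adjoint positive semi-definite $Q$, $\|x\|_Q:=\sqrt{\langle Qx,x\rangle}$. $\nabla_u f$ and $\partial_u g$ denote the gradient and the convex subdifferential with respect to the first argument.
   Formalization: The formal theorem additionally assumes that the new iterate u^{k+1} and the solution S_u(α) both lie in Ũ, where g is strongly convex; without these memberships the inequality can fail when Ũ is a proper subset of U. *)

(* Defs.v *)
From HB Require Import structures.
From mathcomp Require Import all_boot all_order all_algebra.
From mathcomp Require Import all_classical all_reals all_analysis.
Import Order.TTheory GRing.Theory Num.Theory.
Import numFieldNormedType.Exports.

Set Implicit Arguments.
Unset Strict Implicit.
Unset Printing Implicit Defensive.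

Local Open Scope classical_set_scope.
Local Open Scope ring_scope.

(* A real Hilbert space is a complete normed module [V] together with an inner
   product [dot : {dot V for idfun}] (a positive definite symmetric bilinear
   form) that induces the norm of [V]. *)
Definition induces_norm (R : realType) (V : normedModType R)
    (dot : {dot V for idfun}) : Prop :=
  forall x : V, dot x x = `|x| ^+ 2.

Definition normQ (R : realType) (V : normedModType R)
    (dot : {dot V for idfun}) (Q : V -> V) (x : V) : R :=
  Num.sqrt (dot (Q x) x).

Section ConvexAnalysis.
Context {R : realType} {V : normedModType R}.
Implicit Types (h : V -> \bar R) (D : set V).

(* In \bar R one has 0 * +oo = 0, so that at t = 0 and t = 1 the convexity
   inequalities below are harmless. *)
Definition convex_ereal h : Prop :=
  forall (x y : V) (t : R), 0 <= t <= 1 ->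
  (h (t *: x + (1 - t) *: y)%R <= t%:E * h x + (1 - t)%:E * h y)%E.

Definition strongly_convex_on (gamma : R) D h : Prop :=
  forall (x y : V) (t : R), D x -> D y -> 0 <= t <= 1 ->
  (h (t *: x + (1 - t) *: y)%R
     + (gamma / 2 * (t * (1 - t)) * `|x - y| ^+ 2)%:E
   <= t%:E * h x + (1 - t)%:E * h y)%E.

Definition proper h : Prop :=
  (forall x, h x != -oo%E) /\ (exists x, h x != +oo%E).

Definition convex_proper_lsc h : Prop :=
  [/\ convex_ereal h, proper h & lower_semicontinuous h].

Definition subdifferential (dot : {dot V for idfun}) h (x : V) : set V :=
  [set q | h x \is a fin_num
         /\ forall y, (h x + (dot q (y - x)%R)%:E <= h y)%E].

Definition argmin h : set V := [set z | forall y, (h z <= h y)%E].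

(* [get] selects the unique minimiser when there is one, which is the case for
   convex, proper and lower semicontinuous [h] on a Hilbert space. *)
Definition prox h (x : V) : V :=
  get (argmin (fun z => (2^-1 * `|z - x| ^+ 2)%:E + h z)%E).

Definition is_gradient (dot : {dot V for idfun}) (f : V -> R) (x v : V) : Prop :=
  differentiable f x /\ forall w : V, 'd f x w = dot v w.

End ConvexAnalysis.

(* Main.v *)
Require Import Defs.
From mathcomp Require Import all_boot all_order all_algebra.
From mathcomp Require Import all_classical all_reals all_analysis.
From mathcomp Require Import ring lra.
Import Order.TTheory GRing.Theory Num.Theory.
Import numFieldNormedType.Exports.
Local Open Scope classical_set_scope.
Local Open Scope ring_scope.

(** A forward-backward step with data [a] contracts towards the solution
    [S_u a], and [S_u] depends on the data in a Lipschitz way; the tracking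
    inequality is the triangle inequality between these two facts.

    Write [s] for [S_u a], [p] for the new iterate, and [x], [y] for the results
    of the gradient step from [u] and from [s]. The minimality of [p] says that
    [(x - p) / tau] is a subgradient of [g] at [p] ([prox_subgradient]), and the
    inclusion defining [s] says that [(y - s) / tau] is one at [s]. Strong
    convexity makes the subdifferential strongly monotone, so that, by
    Cauchy-Schwarz, [(1 + tau * gamma / 2) * `|p - s| <= `|x - y|]
    ([forward_backward_contraction]). The gradient step does not increase
    distances when [tau * L <= 2], by the cocoercivity of a Lipschitz convex
    gradient ([gradient_step_nonexpansive]), whence [`|x - y| <= `|u - s|].

    Since [prox] is a choice among minimisers, its defining property holds only
    once a minimiser exists. [prox_exists] provides one by the direct method; the
    functional is bounded below because [g] has an affine minorant, given by the
    subgradient at [s]. *)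

(** * The inner product *)

Lemma dot_sym {R : realType} {V : normedModType R} (dot : {dot V for idfun})
  (x y : V) : dot x y = dot y x.
Proof. by rewrite hermC expr0 mul1r. Qed.

Lemma dotZr {R : realType} {V : normedModType R} (dot : {dot V for idfun})
  (c : R) (x y : V) : dot x (c *: y) = c * dot x y.
Proof. exact: linearZ. Qed.

Lemma dotNr {R : realType} {V : normedModType R} (dot : {dot V for idfun})
  (x y : V) : dot x (- y) = - dot x y.
Proof. exact: linearN. Qed.

Lemma dotDr {R : realType} {V : normedModType R} (dot : {dot V for idfun})
  (x y z : V) : dot x (y + z) = dot x y + dot x z.
Proof. exact: linearD. Qed.

Lemma dotNl {R : realType} {V : normedModType R} (dot : {dot V for idfun})
  (x y : V) : dot (- x) y = - dot x y.
Proof. by rewrite dot_sym dotNr dot_sym. Qed.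

Lemma dotZl {R : realType} {V : normedModType R} (dot : {dot V for idfun})
  (c : R) (x y : V) : dot (c *: x) y = c * dot x y.
Proof. by rewrite dot_sym dotZr dot_sym. Qed.

Lemma dotDl {R : realType} {V : normedModType R} (dot : {dot V for idfun})
  (x y z : V) : dot (x + y) z = dot x z + dot y z.
Proof. by rewrite dot_sym dotDr dot_sym (dot_sym _ z y). Qed.

Lemma normD_sqr {R : realType} {V : normedModType R} {dot : {dot V for idfun}}
  (hV : induces_norm dot) (x y : V) :
  `|x + y| ^+ 2 = `|x| ^+ 2 + 2 * dot x y + `|y| ^+ 2.
Proof.
by have := dot_sym dot y x; rewrite -!hV dotDl !dotDr => ->; ring.
Qed.

Lemma normB_sqr {R : realType} {V : normedModType R} {dot : {dot V for idfun}}
  (hV : induces_norm dot) (x y : V) :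
  `|x - y| ^+ 2 = `|x| ^+ 2 - 2 * dot x y + `|y| ^+ 2.
Proof. by rewrite (normD_sqr hV) dotNr normrN mulrN. Qed.

(** Cauchy-Schwarz comes for free from the triangle inequality, since the norm
    is assumed to be a norm already: expand the square of [`|x + y|]. *)
Lemma dot_le_norm {R : realType} {V : normedModType R} {dot : {dot V for idfun}}
  (hV : induces_norm dot) (x y : V) : dot x y <= `|x| * `|y|.
Proof.
have := normD_sqr hV x y.
have : `|x + y| ^+ 2 <= (`|x| + `|y|) ^+ 2.
  by rewrite ler_sqr ?nnegrE ?addr_ge0//; exact: ler_normD.
by rewrite sqrrD; lra.
Qed.

(** * Convex functions with Lipschitz gradient *)

Lemma is_derive_along_line {R : realType} {V : normedModType R}
  {dot : {dot V for idfun}} {f : V -> R} (x d v : V) (t : R) :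
  is_gradient dot f (t *: d + x) v ->
  is_derive t 1 (fun s : R => f (s *: d + x)) (dot v d).
Proof.
move=> [df dfE].
have hl : is_diff t (fun s : R => s *: d + x) (fun s : R => s *: d).
  by apply: is_diff_eq; rewrite funeqE => s /=; rewrite addr0.
have hf : is_diff (t *: d + x) f ('d f (t *: d + x)).
  by apply: DiffDef.
have [h1 h2] := @is_diff_comp _ _ _ _ _ _ _ _ _ hl hf.
split; first exact: diff_derivable.
by rewrite deriveE//= h2 /= dfE scale1r.
Qed.

(** The descent lemma. At [t *: (y - x) + x], the left side minus the right side
    is, up to a constant, the function [phi] of [t]; its derivative is nonpositive
    on the unit interval, by Cauchy-Schwarz and the Lipschitz bound. *)
Lemma lipschitz_gradient_le {R : realType} {V : normedModType R}
  {dot : {dot V for idfun}} (hV : induces_norm dot) (f : V -> R) (df : V -> V)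
  (L : R) (hdf : forall x, is_gradient dot f x (df x)) (hL : L.-lipschitz df)
  (x y : V) : f y <= f x + dot (df x) (y - x) + L / 2 * `|y - x| ^+ 2.
Proof.
set d := y - x.
pose phi t := f (t *: d + x) - t * dot (df x) d - t ^+ 2 * (L / 2 * `|d| ^+ 2).
pose dphi t := dot (df (t *: d + x) - df x) d - t * (L * `|d| ^+ 2).
have hphi (t : R) : is_derive t 1 phi (dphi t).
  have ? := is_derive_along_line x d _ t (hdf (t *: d + x)).
  apply: is_derive_eq.
  by rewrite /dphi linearBl /= /GRing.scale/=; field.
have [t ht] : exists2 t, t \in `]0, 1[%R & phi 1 - phi 0 = dphi t * (1 - 0).
  apply: MVT => //.
  apply: derivable_within_continuous => t _.
  by case: (hphi t).
move: ht; rewrite in_itv /= => /andP[t0 t1].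
rewrite /phi scale1r scale0r add0r subrK.
have : dphi t <= 0.
  rewrite /dphi subr_le0.
  apply: le_trans (dot_le_norm hV _ _) _.
  have := hL (t *: d + x, x) (conj I I).
  rewrite /= /self_sub /= addrK normrZ gtr0_norm // => h.
  have := normr_ge0 d; nra.
lra.
Qed.

(** Convexity bounds the difference quotients of [f] from [x] towards [y] by
    [f y - f x]; their limit from the right is the directional derivative. *)
Lemma gradient_subgradient {R : realType} {V : normedModType R}
  {dot : {dot V for idfun}} (f : V -> R) (x v y : V) :
  convex_ereal (fun u => (f u)%:E) -> is_gradient dot f x v ->
  f x + dot v (y - x) <= f y.
Proof.
move=> cf gf; set d := y - x.
pose phi t := f (t *: d + x).
have [dphi phi'E] : is_derive (0 : R) (1 : R) phi (dot v d).
  by apply: (is_derive_along_line x); rewrite scale0r add0r.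
have phi'_right : (fun t : R => t^-1 *: ((phi \o shift 0) (t *: 1) - phi 0))
    @ at_right 0 --> dot v d.
  rewrite -phi'E; apply: cvg_trans dphi; apply: cvg_app => S [e e0 eS].
  by exists e => // t te t0; apply: eS => //; exact/lt0r_neq0.
rewrite -lerBrDl; apply: (cvgr_to_le phi'_right).
near=> t.
have t0 : 0 < t by near: t; exact: nbhs_right_gt.
have t1 : t <= 1 by near: t; exact: nbhs_right_le.
rewrite /= /phi addr0 scale0r add0r /GRing.scale/= mulr1.
rewrite ler_pdivrMl//.
have := cf y x t; rewrite t1 ltW// => /(_ isT); rewrite -!EFinM -EFinD lee_fin.
have -> : t *: y + (1 - t) *: x = t *: d + x.
  by rewrite /d scalerBl scale1r scalerBr addrA addrAC.
lra.
Unshelve. all: by end_near. Qed.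

(** One half of the Baillon-Haddad inequality. The tangent of [f] at [x] is
    compared with [f] at the point reached from [y] by a gradient step of length
    [tau / 2] for the convex function [f - dot (df x)]. That step stays in the
    range [tau / 2 * L <= 1] where the descent lemma guarantees a decrease of
    [tau / 4] times the squared gradient. Working with [tau] in place of the
    inverse of [L] avoids a case distinction on [L]. *)
Lemma convex_gradient_gap {R : realType} {V : normedModType R}
  {dot : {dot V for idfun}} (hV : induces_norm dot) (f : V -> R) (df : V -> V)
  (L tau : R) (cf : convex_ereal (fun u => (f u)%:E))
  (hdf : forall x, is_gradient dot f x (df x)) (hL : L.-lipschitz df)
  (tau0 : 0 <= tau) (tauL : tau * L <= 2) (x y : V) :
  f x + dot (df x) (y - x) + tau / 4 * `|df y - df x| ^+ 2 <= f y.
Proof.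
set G := df y - df x.
have := gradient_subgradient f x (df x) (y - (tau / 2) *: G) cf (hdf x).
have := lipschitz_gradient_le hV _ _ _ hdf hL y (y - (tau / 2) *: G).
have -> : y - (tau / 2) *: G - y = - ((tau / 2) *: G).
  by rewrite addrAC subrr add0r.
rewrite (addrAC y) (dotDr _ _ (y - x)) !dotNr !dotZr normrN normrZ ger0_norm;
  last by lra.
have : dot (df y) G - dot (df x) G = `|G| ^+ 2 by rewrite -dotNl -dotDl -hV.
have := sqr_ge0 `|G|.
move: (dot (df y) G) (dot (df x) G) (dot (df x) (y - x))
  (f (y - _)) `|G| => p q r F n.
rewrite exprMn; move: (n ^+ 2) => N N0 E.
have : tau * (tau * L) * N <= tau * 2 * N by rewrite ler_wpM2r// ler_wpM2l.
have : tau * p - tau * q = tau * N by rewrite -mulrBr E.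
lra.
Qed.

(** Adding [convex_gradient_gap] to itself with [x] and [y] exchanged gives the
    cocoercivity of [df], which is what makes the cross term in the expanded
    square absorb [tau ^+ 2 * `|df x - df y| ^+ 2]. *)
Lemma gradient_step_nonexpansive {R : realType} {V : normedModType R}
  {dot : {dot V for idfun}} (hV : induces_norm dot) (f : V -> R) (df : V -> V)
  (L tau : R) (cf : convex_ereal (fun u => (f u)%:E))
  (hdf : forall x, is_gradient dot f x (df x)) (hL : L.-lipschitz df)
  (tau0 : 0 <= tau) (tauL : tau * L <= 2) (x y : V) :
  `|(x - tau *: df x) - (y - tau *: df y)| <= `|x - y|.
Proof.
have gxy := convex_gradient_gap hV _ _ _ _ cf hdf hL tau0 tauL x y.
have gyx := convex_gradient_gap hV _ _ _ _ cf hdf hL tau0 tauL y x.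
rewrite -ler_sqr ?nnegrE//.
have -> : (x - tau *: df x) - (y - tau *: df y) =
    (x - y) - tau *: (df x - df y).
  by rewrite scalerBr !opprB (addrC (tau *: df y)) addrACA (addrC (tau *: df y)).
have := normB_sqr hV (x - y) (tau *: (df x - df y)).
rewrite normrZ ger0_norm// exprMn dotZr => ->.
suff : tau / 2 * `|df x - df y| ^+ 2 <= dot (x - y) (df x - df y).
  by move=> /(ler_wpM2l tau0); lra.
have -> : dot (x - y) (df x - df y) = - dot (df x) (y - x) - dot (df y) (x - y).
  by rewrite dot_sym -dotNr opprB -dotNl -dotDl.
by move: gxy gyx; rewrite (distrC (df y)); lra.
Qed.

(** * Subgradients of extended-valued convex functions *)

Lemma convex_le_fin {R : realType} {V : normedModType R} {g : V -> \bar R}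
  (cg : convex_ereal g) (pg : Defs.proper g) {y z : V} {a b t : R} :
  g y = a%:E -> g z = b%:E -> 0 <= t <= 1 ->
  exists2 c, g (t *: y + (1 - t) *: z) = c%:E & c <= t * a + (1 - t) * b.
Proof.
move=> gy gz /(cg y z); rewrite gy gz -!EFinM -EFinD.
have := pg.1 (t *: y + (1 - t) *: z).
by case: (g _) => [c| |]// _; rewrite lee_fin; exists c.
Qed.

(** Strong convexity at the midpoint of [x] and [y], against the subgradient
    inequality there. Letting the point tend to [x] instead would give the sharp
    constant [gamma / 2], but any positive multiple of [gamma] yields a
    contraction. *)
Lemma strongly_convex_subgradient_gap {R : realType} {V : normedModType R}
  {dot : {dot V for idfun}} {g : V -> \bar R} {gamma : R} {D : set V}
  {x y q : V} {a b : R} :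
  strongly_convex_on gamma D g -> D x -> D y -> subdifferential dot g x q ->
  g x = a%:E -> g y = b%:E ->
  a + dot q (y - x) + gamma / 4 * `|y - x| ^+ 2 <= b.
Proof.
move=> sg Dx Dy [_ qx] gx gy.
have half01 : 0 <= (2^-1 : R) <= 1 by apply/andP; split; lra.
have := sg y x 2^-1 Dy Dx half01.
have := qx (2^-1 *: y + (1 - 2^-1) *: x).
rewrite gx gy -!EFinM -!EFinD; case: (g _) => [c| |]//.
have -> : 2^-1 *: y + (1 - 2^-1) *: x - x = 2^-1 *: (y - x).
  by rewrite scalerBl scale1r scalerBr addrA addrAC addrK.
by rewrite -EFinD !lee_fin dotZr; lra.
Qed.

Lemma strongly_convex_subgradient_monotone {R : realType} {V : normedModType R}
  {dot : {dot V for idfun}} {g : V -> \bar R} {gamma : R} {D : set V}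
  {x y p q : V} :
  strongly_convex_on gamma D g -> D x -> D y ->
  subdifferential dot g x p -> subdifferential dot g y q ->
  gamma / 2 * `|x - y| ^+ 2 <= dot (p - q) (x - y).
Proof.
move=> sg Dx Dy px qy.
have [/fineK/esym gx _] := px; have [/fineK/esym gy _] := qy.
have := strongly_convex_subgradient_gap sg Dx Dy px gx gy.
have := strongly_convex_subgradient_gap sg Dy Dx qy gy gx.
rewrite (distrC y) -(opprB x y) dotNr dotDl dotNl; lra.
Qed.

(** * The proximal point *)

(** Fermat's rule. Comparing [p] with the points of the segment from [p] to [y],
    convexity of [g] gives the subgradient inequality up to an error of order
    [t] in the position [t] on the segment, and [t] is then sent to [0]. *)
Lemma prox_subgradient {R : realType} {V : normedModType R}
  {dot : {dot V for idfun}} (hV : induces_norm dot) {g : V -> \bar R}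
  {tau : R} {x p : V} :
  convex_ereal g -> Defs.proper g -> 0 < tau ->
  argmin (fun z => (2^-1 * `|z - x| ^+ 2)%:E + tau%:E * g z)%E p ->
  subdifferential dot g p (tau^-1 *: (x - p)).
Proof.
move=> cg pg tau0 pmin.
have [c gp] : exists c, g p = c%:E.
  have [gNy [y gy]] := pg; have := pmin y; move: (gNy y) (gNy p) gy.
  case: (g y) => [b| |]// _; case: (g p) => [c| |]// _ _; first by exists c.
  by rewrite gt0_muley ?lte_fin// -EFinM -EFinD.
split; first by rewrite gp.
move=> y; have := pg.1 y; case gy : (g y) => [b| |]// _; last exact: leey.
rewrite gp -EFinD lee_fin dotZl.
set d := y - p.
have small (t : R) : 0 < t -> t <= 1 ->
    tau * c + dot (x - p) d - t / 2 * `|d| ^+ 2 <= tau * b.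
  move=> t0 t1; have t01 : 0 <= t <= 1 by rewrite ltW.
  have [e ge ele] := convex_le_fin cg pg gy gp t01.
  have := pmin (t *: y + (1 - t) *: p).
  rewrite ge gp -!EFinM -!EFinD lee_fin.
  have -> : t *: y + (1 - t) *: p - x = (p - x) + t *: d.
    by rewrite /d scalerBl scale1r scalerBr addrCA addrAC.
  have := normD_sqr hV (p - x) (t *: d); rewrite dotZr => ->.
  rewrite -(opprB x p) dotNl normrZ gtr0_norm// exprMn => pmin_t.
  have tau_e : tau * e <= tau * (t * b + (1 - t) * c) by rewrite ler_pM2l.
  by rewrite -(ler_pM2l t0); lra.
rewrite -(ler_pM2l tau0) mulrDr mulrA divff ?gt_eqF// mul1r.
apply/ler_addgt0Pr => eps eps0.
have N0 : 0 < `|d| ^+ 2 + 1 by rewrite ltr_wpDl// sqr_ge0.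
(* The summand 1 in the denominator covers the case d = 0. *)
pose t := Num.min 1 (eps / (`|d| ^+ 2 + 1)).
have t0 : 0 < t by rewrite lt_min ltr01 divr_gt0.
have t1 : t <= 1 by rewrite ge_min lexx.
have : t * (`|d| ^+ 2 + 1) <= eps.
  by rewrite -ler_pdivlMr// ge_min lexx orbT.
have := small t t0 t1.
have : 0 <= t * `|d| ^+ 2 by rewrite mulr_ge0 ?sqr_ge0 ?ltW.
lra.
Qed.

(** The direct method. The quadratic term makes the functional strongly convex,
    so that by the parallelogram law a minimising sequence is Cauchy; lower
    semicontinuity makes its limit a minimiser. The subgradient [q] enters only
    as an affine minorant of [g], which the quadratic term dominates. *)
Lemma prox_exists {R : realType} {V : completeNormedModType R}
  {dot : {dot V for idfun}} (hV : induces_norm dot) {g : V -> \bar R}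
  {tau : R} {s q : V} (x : V) :
  convex_proper_lsc g -> 0 < tau -> subdifferential dot g s q ->
  exists p, argmin (fun z => (2^-1 * `|z - x| ^+ 2)%:E + tau%:E * g z)%E p.
Proof.
move=> [cg pg lg] tau0 [/fineK/esym gs qs].
move: (fine _) gs => a gs.
pose phi z := 2^-1 * `|z - x| ^+ 2 + tau * fine (g z).
pose E := phi @` [set z | g z \is a fin_num].
have E0 : E !=set0 by exists (phi s), s => //=; rewrite gs.
have Elb : has_lbound E.
  (* The minimum over z of 2^-1 * `|z - x| ^+ 2 plus tau times the minorant. *)
  exists (tau * (a + dot q (x - s)) - tau ^+ 2 / 2 * `|q| ^+ 2).
  move=> _ [z /= /fineK/esym gz <-]; rewrite /phi.
  have := qs z; rewrite gs gz -EFinD lee_fin -[in z - s](subrK x z) -addrA dotDr.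
  move=> /(ler_wpM2l (ltW tau0)).
  have := sqr_ge0 `|(z - x) + tau *: q|.
  have := normD_sqr hV (z - x) (tau *: q).
  rewrite dotZr normrZ gtr0_norm// exprMn (dot_sym dot (z - x)) => ->.
  by rewrite /=; lra.
have [m_lb m_adh] : (forall z b, g z = b%:E -> inf E <= phi z) /\
    (forall e, 0 < e -> exists z, g z \is a fin_num /\ phi z < inf E + e).
  split=> [z b gz|e e0].
    by apply: ge_inf => //; exists z => //=; rewrite gz.
  by have [_ [z gz <-]] := inf_adherent e0 (conj E0 Elb); exists z.
move: (inf E) m_lb m_adh => m m_lb m_adh.
have /choice[z_ z_min] : forall n : nat, exists z,
    g z \is a fin_num /\ phi z < m + n.+1%:R^-1.
  by move=> n; apply: m_adh; rewrite invr_gt0 ltr0n.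
have gap i j : `|z_ i - z_ j| ^+ 2 <= 4 * (i.+1%:R^-1 + j.+1%:R^-1).
  have [/fineK/esym gi hi] := z_min i; have [/fineK/esym gj hj] := z_min j.
  have half01 : 0 <= (2^-1 : R) <= 1 by apply/andP; split; lra.
  have [c gc] := convex_le_fin cg pg gi gj half01.
  have := m_lb _ _ gc; rewrite /phi gc /=.
  have -> : 2^-1 *: z_ i + (1 - 2^-1) *: z_ j - x =
      2^-1 *: ((z_ i - x) + (z_ j - x)).
    have half1 : 1 - 2^-1 = 2^-1 :> R by lra.
    have half2 : 2^-1 + 2^-1 = 1 :> R by lra.
    rewrite half1 addrACA -opprD scalerBr (scalerDr _ x x) -scalerDl half2 scale1r.
    by rewrite scalerDr.
  have -> : z_ i - z_ j = (z_ i - x) - (z_ j - x) by rewrite opprB addrA subrK.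
  move: hi hj; rewrite /phi normrZ ger0_norm// exprMn
    (normD_sqr hV (z_ i - x)) (normB_sqr hV (z_ i - x)).
  move: (i.+1%:R^-1) (j.+1%:R^-1) => ei ej hi hj h1.
  by move=> /(ler_wpM2l (ltW tau0)); lra.
have z_cvg : cvg (z_ @ \oo).
  apply/cauchy_cvgP/cauchy_ballP => e e0.
  have e8 : 0 < e ^+ 2 / 8 by rewrite divr_gt0// exprn_gt0.
  have [N _ hN] := near_infty_natSinv_lt (PosNum e8).
  pose tail := z_ @` [set n | (N <= n)%N].
  exists (tail, tail); first by split; exists N => // n Nn; exists n.
  move=> [_ _] [/= [i /hN/= hi <-] [j /hN/= hj <-]].
  rewrite -ball_normE /ball_ /= -ltr_sqr ?nnegrE//; last exact: ltW.
  apply: le_lt_trans (gap i j) _.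
  by move: (i.+1%:R^-1) (j.+1%:R^-1) hi hj => ei ej; lra.
move: z_cvg => /cvg_ex[p zp].
(* As g p is not yet known to be finite, semicontinuity is used through the
   reals below it. *)
have p_min b : (b%:E < g p)%E -> 2^-1 * `|p - x| ^+ 2 + tau * b <= m.
  move=> /lg[W /zp zW gW].
  have cv : 2^-1 * `|z_ n - x| ^+ 2 + tau * b - n.+1%:R^-1 @[n --> \oo] -->
      2^-1 * `|p - x| ^+ 2 + tau * b - 0.
    apply: cvgB; last exact: cvg_harmonic.
    apply: cvgD; last exact: cvg_cst.
    apply: cvgM; first exact: cvg_cst.
    under eq_fun do rewrite expr2.
    rewrite expr2.
    by apply: cvgM; apply: cvg_norm; apply: cvgB => //; exact: cvg_cst.
  rewrite -[leLHS]subr0; apply: (cvgr_to_le cv).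
  near=> n.
  have [/fineK/esym gn hn] := z_min n.
  have : (b%:E < g (z_ n))%E by apply: gW; near: n.
  rewrite gn lte_fin -(ltr_pM2l tau0) /=.
  by move: (n.+1%:R^-1) hn => en; rewrite /phi; lra.
have [c gp] : exists c, g p = c%:E.
  have := pg.1 p; case gpE : (g p) => [c| |]// _; first by exists c.
  have := p_min ((m + 1) / tau); rewrite gpE ltry => /(_ isT).
  rewrite (mulrC tau) divfK ?gt_eqF//.
  by have := sqr_ge0 `|p - x|; lra.
have p_le_m : 2^-1 * `|p - x| ^+ 2 + tau * c <= m.
  apply/ler_addgt0Pr => e e0.
  have := p_min (c - e / tau); rewrite gp lte_fin ltrBlDr ltrDl divr_gt0//.
  move=> /(_ isT); rewrite mulrBr (mulrC tau (_ / _)) divfK ?gt_eqF//; lra.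
exists p => y; rewrite gp.
have := pg.1 y; case gy : (g y) => [b| |]// _.
  rewrite -!EFinM -!EFinD lee_fin (le_trans p_le_m)//.
  by have := m_lb _ _ gy; rewrite /phi gy.
by rewrite gt0_muley ?lte_fin// addey ?leey.
Unshelve. all: by end_near. Qed.

(** * Tracking by a forward-backward step *)

(** [p] and [s] are meant to be the proximal points of [x] and [y], and the two
    subgradient hypotheses are their optimality conditions. Subtracting these
    turns strong monotonicity into
    [(1 + tau * gamma / 2) * `|p - s| ^+ 2 <= dot (x - y) (p - s)]. *)
Lemma forward_backward_contraction {R : realType} {V : normedModType R}
  {dot : {dot V for idfun}} (hV : induces_norm dot) {g : V -> \bar R}
  {D : set V} {gamma tau : R} {x y p s : V} :
  strongly_convex_on gamma D g -> 0 < tau -> D p -> D s ->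
  subdifferential dot g p (tau^-1 *: (x - p)) ->
  subdifferential dot g s (tau^-1 *: (y - s)) ->
  (1 + tau * gamma / 2) * `|p - s| <= `|x - y|.
Proof.
move=> sg tau0 Dp Ds hp hs.
have := strongly_convex_subgradient_monotone sg Dp Ds hp hs.
have -> : tau^-1 *: (x - p) - tau^-1 *: (y - s) = tau^-1 *: ((x - y) - (p - s)).
  by rewrite -scalerBr; congr (_ *: _); rewrite !opprB (addrC s) addrACA (addrC s).
rewrite dotZl dotDl dotNl hV -(ler_pM2l tau0) !mulrA divff ?gt_eqF// mul1r => mono.
have := dot_le_norm hV (x - y) (p - s).
have := normr_ge0 (p - s); rewrite le_eqVlt => /predU1P[<- _|ps0 cs].
  by rewrite mulr0.
by rewrite -(ler_pM2r ps0); lra.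
Qed.

Lemma normQ_scale {R : realType} {V : normedModType R}
  {dot : {dot V for idfun}} (hV : induces_norm dot) {c : R} (x : V) :
  0 <= c -> normQ dot (fun u => c *: u) x = Num.sqrt c * `|x|.
Proof.
by move=> c0; rewrite /normQ dotZl hV sqrtrM// sqrtr_sqr normr_id.
Qed.

Theorem theorem3p4 (R : realType) (U A : completeNormedModType R)
  (dotU : {dot U for idfun}) (dotA : {dot A for idfun})
  (hU : induces_norm dotU) (hA : induces_norm dotA)
  (Ut : set U) (At : set A)
  (f : U -> A -> R) (g : U -> A -> \bar R)
  (gradf : U -> A -> U) (S_u : A -> U)
  (L gamma L_Su tau : R)
  (hf : forall a : A, convex_proper_lsc (fun u => (f u a)%:E))
  (hg : forall a : A, convex_proper_lsc (g^~ a))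
  (hgradf : forall (u : U) (a : A), is_gradient dotU (f^~ a) u (gradf u a))
  (hL : forall a : A, L.-lipschitz (gradf^~ a))
  (hgamma : 0 < gamma)
  (hstrong : forall a : A, strongly_convex_on gamma Ut (g^~ a))
  (hS : forall a : A, At a ->
    [set u : U | [set gradf u a + q | q in subdifferential dotU (g^~ a) u] 0]
    = [set S_u a])
  (hLS : L_Su.-lipschitz_At S_u)
  (htau : 0 < tau) (htauL : tau * L <= 2) :
  let Q := fun u : U => tau^-1 *: u in
  exists kappa_u pi_u : R, [/\ 1 < kappa_u, 0 < pi_u &
    forall (u : U) (a a_ : A), Ut u -> At a -> At a_ ->
    let u' := prox (fun z => (tau%:E * g z a)%E) (u - tau *: gradf u a) in
    Ut u' -> Ut (S_u a) ->
    kappa_u * normQ dotU Q (u' - S_u a)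
      <= normQ dotU Q (u - S_u a_) + pi_u * `|a - a_|].
Proof.
move=> Q.
have taui : 0 < tau^-1 by rewrite invr_gt0.
have sqrt_pos : 0 < Num.sqrt tau^-1 by rewrite sqrtr_gt0.
(* The summand 1 keeps pi positive even when L_Su is not. *)
exists (1 + tau * gamma / 2), (Num.sqrt tau^-1 * (`|L_Su| + 1)); split.
- by rewrite ltrDl divr_gt0// mulr_gt0.
- by rewrite mulr_gt0// ltr_wpDl.
move=> u a a_ _ Ata Ata_ u' Utu' Uts.
have [q sq] : [set gradf (S_u a) a + q |
    q in subdifferential dotU (g^~ a) (S_u a)] 0.
  by have : [set S_u a] (S_u a) by []; rewrite -hS.
rewrite addrC => /eqP; rewrite addr_eq0 => /eqP qE; rewrite {}qE in sq.
have prox_min := getPex (prox_exists hU (u - tau *: gradf u a) (hg a) htau sq).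
have [cg pg _] := hg a.
have u'_sub := prox_subgradient hU cg pg htau prox_min.
(* The inclusion for S_u a says that S_u a is a fixed point of the step. *)
have s_sub : subdifferential dotU (g^~ a) (S_u a)
    (tau^-1 *: ((S_u a - tau *: gradf (S_u a) a) - S_u a)).
  by rewrite addrAC subrr add0r scalerN scalerA mulVf ?gt_eqF// scale1r.
have contr :=
  forward_backward_contraction hU (hstrong a) htau Utu' Uts u'_sub s_sub.
have [cf _ _] := hf a.
have step := gradient_step_nonexpansive hU _ _ _ _ cf (hgradf^~ a) (hL a)
  (ltW htau) htauL u (S_u a).
have tri : `|u - S_u a| <= `|u - S_u a_| + `|S_u a - S_u a_|.
  by rewrite (distrC (S_u a)) -[in leLHS](subrK (S_u a_) u) -addrA ler_normD.
have lip : `|S_u a - S_u a_| <= (`|L_Su| + 1) * `|a - a_|.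
  apply: le_trans (hLS (a, a_) (conj Ata Ata_)) _.
  by rewrite ler_wpM2r// (le_trans (ler_norm _))// lerDl.
rewrite !(normQ_scale hU _ (ltW taui)) mulrCA -(mulrA (Num.sqrt _)) -mulrDr.
rewrite ler_pM2l//.
apply: le_trans (le_trans contr step) _.
by apply: le_trans tri _; rewrite lerD2l.
Qed.
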